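(* Let $f$ be a $C^4$ function in a disk $D\subset\mathbb{R}^2$. Suppose that through each point $(x,y,z)$ of the graph of $f$ there passes an arc of a nonmultiple conic $C_{x,y}$ having contact order $4$ at $(x,y,z)$ with the graph, continuously depending on $(x,y)$, and such that the top view of $C_{x,y}$ is the stereographic projection of a circular arc of intrinsic radius $\frac{\pi}{2}-\theta$ in the unit sphere (not passing through the projection center $(0,0,-1)$). Then an arc of the conic $C_{x,y}$ is contained in the graph.
   Context: Fix $\theta\in(0,\pi/2)$. The top view is the projection $(x,y,z)\mapsto(x,y,0)$. Stereographic projection is from the point $(0,0,-1)$ of the unit sphere centered at the origin to the plane $z=0$: $(n_1,n_2,n_3)\mapsto\left(\frac{n_1}{n_3+1},\frac{n_2}{n_3+1}\right)$. Intrinsic radius is the spherical radius of a circle in the unit sphere. Each such conic $C_{x,y}$ through $(x,y,z)$ is parametrized as $$x(t)=x+v\sin t+u(1-\cos t),\quad y(t)=y-u\sin t+v(1-\cos t),\quad z(t)=z+a\sin t+b(1-\cos t)$$ with $a,b,u,v\in\mathbb{R}$, so that $(x+u,y+v)$ is the center of the top-view circle and $t=0$ corresponds to the point $(x,y,z)$; continuous dependence on $(x,y)$ means continuous dependence of these coefficients. A curve $(x(t),y(t),z(t))$ with $(\dot x,\dot y)\neq0$ has contact of order $n$ with the graph of a $C^n$ function $f$ at $t=0$ if $\frac{z(t)-f(x(t),y(t))}{t^n}\to0$ as $t\to0$. The conic parametrized by $x(t)=x+v\sin t+u(1-\cos t)$, $y(t)=y-u\sin t+v(1-\cos t)$, $z(t)=z+a\sin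 t+b(1-\cos t)$ is multiple if $(u,v)$ is a common real multiple root of the two equations (in the unknowns $(u,v)$, for fixed $(x,y)$, derivatives of $f$ evaluated at $(x,y)$) $$(x^2+y^2+1+2xu+2yv)^2-4\tan^2\theta\,(u^2+v^2)=0,$$ $$f_{xxx}v^3-3f_{xxy}v^2u+3f_{xyy}vu^2-f_{yyy}u^3+3(f_{xx}-f_{yy})uv+3f_{xy}(v^2-u^2)=0,$$ i.e. a common real root at which the Jacobian determinant of the two left-hand sides with respect to $(u,v)$ vanishes; otherwise it is nonmultiple. *)

(* Defs.v *)
From Stdlib Require Import Reals.
From Coquelicot Require Import Coquelicot.

Open Scope R_scope.

Definition point3 : Type := (R * R * R)%type.

Definition dot3 (p q : point3) : R :=
  let '(p1, p2, p3) := p in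
  let '(q1, q2, q3) := q in
  p1 * q1 + p2 * q2 + p3 * q3.

Definition on_sphere (p : point3) : Prop := dot3 p p = 1.

Definition spherical_dist (p q : point3) : R := acos (dot3 p q).

Definition on_spherical_circle (c : point3) (rho : R) (p : point3) : Prop :=
  on_sphere p /\ spherical_dist c p = rho.

(** Image of a nonconstant continuous path in the circle: a nondegenerate
    closed arc, possibly the whole circle. *)
Definition circular_arc (rho : R) (A : point3 -> Prop) : Prop :=
  exists (c : point3) (gamma : R -> point3),
    on_sphere c /\
    (forall s, 0 <= s <= 1 -> continuous gamma s) /\
    (forall s, 0 <= s <= 1 -> on_spherical_circle c rho (gamma s)) /\
    (exists s s', 0 <= s <= 1 /\ 0 <= s' <= 1 /\ gamma s <> gamma s') /\
    (forall p, A p <-> exists s, 0 <= s <= 1 /\ gamma s = p).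

Definition south_pole : point3 := (0, 0, -1).

(** Meaningful away from [south_pole] only. *)
Definition stereographic (p : point3) : R * R :=
  let '(n1, n2, n3) := p in (n1 / (n3 + 1), n2 / (n3 + 1)).

(** Coefficients normalized so that [t = 0] gives the base point and
    [(x + u, y + v)] is the center of the top-view circle. *)
Definition conic_x (x u v t : R) : R := x + v * sin t + u * (1 - cos t).
Definition conic_y (y u v t : R) : R := y - u * sin t + v * (1 - cos t).
Definition conic_z (z a b t : R) : R := z + a * sin t + b * (1 - cos t).

(** Only some arc of the conic around the base point is constrained. *)
Definition top_view_is_projected_arc (rho x y u v : R) : Prop :=
  exists (t0 t1 : R) (A : point3 -> Prop),
    t0 < 0 < t1 /\
    circular_arc rho A /\
    ~ A south_pole /\
    (forall q : R * R,
       (exists t, t0 <= t <= t1 /\ q = (conic_x x u v t, conic_y y u v t)) <->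
       (exists p, A p /\ q = stereographic p)).

Definition contact_order (n : nat) (f : R -> R -> R) (X Y Z : R -> R) : Prop :=
  (Derive X 0, Derive Y 0) <> (0, 0) /\
  is_lim (fun t => (Z t - f (X t) (Y t)) / t ^ n) 0 0.

(** Vanishes iff the circle through [(x, y)] centered at [(x + u, y + v)] is the
    projection of a circle of intrinsic radius [PI / 2 - theta]. *)
Definition top_view_poly (theta x y u v : R) : R :=
  (x ^ 2 + y ^ 2 + 1 + 2 * x * u + 2 * y * v) ^ 2
  - 4 * tan theta ^ 2 * (u ^ 2 + v ^ 2).

(** The third derivative at [t = 0] of [f] along the conic's top view, plus the
    first one; it vanishes under contact of order 3, as [z''' + z' = 0].
    [partial_derive m k f] differentiates [m] times in the first variable and
    [k] times in the second. *)
Definition contact_poly (f : R -> R -> R) (x y u v : R) : R :=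
  partial_derive 3 0 f x y * v ^ 3
  - 3 * partial_derive 2 1 f x y * v ^ 2 * u
  + 3 * partial_derive 1 2 f x y * v * u ^ 2
  - partial_derive 0 3 f x y * u ^ 3
  + 3 * (partial_derive 2 0 f x y - partial_derive 0 2 f x y) * u * v
  + 3 * partial_derive 1 1 f x y * (v ^ 2 - u ^ 2).

Definition jacobian2 (F G : R -> R -> R) (u v : R) : R :=
  Derive (fun s => F s v) u * Derive (fun s => G u s) v
  - Derive (fun s => F u s) v * Derive (fun s => G s v) u.

Definition multiple_conic (theta : R) (f : R -> R -> R) (x y u v : R) : Prop :=
  top_view_poly theta x y u v = 0 /\
  contact_poly f x y u v = 0 /\
  jacobian2 (top_view_poly theta x y) (contact_poly f x y) u v = 0.

Definition in_disk (x0 y0 r x y : R) : Prop :=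
  (x - x0) ^ 2 + (y - y0) ^ 2 < r ^ 2.

(** On an open set, [ex_diff_n f n] at every point says that all partial
    derivatives up to order [n] exist and are continuous. *)
Definition Cn_in (D : R -> R -> Prop) (n : nat) (f : R -> R -> R) : Prop :=
  forall x y, D x y -> ex_diff_n f n x y.

Definition continuous_in (D : R -> R -> Prop) (g : R -> R -> R) : Prop :=
  forall x y, D x y -> continuity_2d_pt g x y.

(* Main.v *)
(** Move along the top-view circle of the conic [C_{x,y}], rotating [(u, v)] with
    the point, so that [x' = v], [y' = -u], [u' = -v], [v' = u]. Then
    [g(t) = f(x(t), y(t))] satisfies [g''' + g' = q], where [q] is [contact_poly] along
    the motion, and it suffices to show [q = 0]: then [g] and [z] solve the same
    third-order equation with the same initial data.

    At the moving point, compare [(u, v)] with the coefficients [(u2, v2)] of the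
    conic attached to that point. Both are roots of [top_view_poly], the moving
    one because the circle does not change. By contact of order 4, [(u2, v2)] is
    also a root of [contact_poly] and of the expression [contact_poly'] that
    gives [q']. Since the root at [t = 0] is simple and [u2], [v2] are continuous,
    the divided differences of the two polynomial equations bound
    [(u - u2, v - v2)] linearly by [q]. As [q'] is in turn linear in these
    differences, [q' = m q] with [m] bounded near 0, and [q(0) = 0] gives [q = 0]. *)

Require Import Defs.
From Stdlib Require Import Reals Lra Lia Factorial.
From Coquelicot Require Import Coquelicot.
Open Scope R_scope.

(** * One-variable analysis: Taylor bounds, Gronwall uniqueness, linear equations *)

Lemma nonneg_derivative_le (h dh : R -> R) (d : R) :
  (forall t, 0 <= t < d -> is_derive h t (dh t)) ->
  (forall t, 0 <= t < d -> 0 <= dh t) ->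
  forall t, 0 <= t < d -> h 0 <= h t.
Proof.
  intros Hd Hp t Ht.
  destruct (MVT_gen h 0 t dh) as [c [Hc E]].
  - rewrite Rmin_left, Rmax_right by lra. intros s Hs. apply Hd; lra.
  - rewrite Rmin_left, Rmax_right by lra. intros s Hs.
    apply derivable_continuous_pt. exists (dh s). apply is_derive_Reals, Hd; lra.
  - rewrite Rmin_left, Rmax_right in Hc by lra.
    assert (0 <= dh c) by (apply Hp; lra). nra.
Qed.

Lemma zero_derivative_eq (h : R -> R) (d : R) :
  (forall t, Rabs t < d -> is_derive h t 0) ->
  forall t, Rabs t < d -> h t = h 0.
Proof.
  intros Hd t Ht.
  assert (Hs : forall s, Rmin 0 t <= s <= Rmax 0 t -> Rabs s < d).
  { intros s. unfold Rmin, Rmax. destruct (Rle_dec 0 t); intros;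
      apply Rabs_def2 in Ht; apply Rabs_def1; lra. }
  destruct (MVT_gen h 0 t (fun _ => 0)) as [c [Hc E]].
  - intros s H. apply Hd, Hs; lra.
  - intros s H. apply derivable_continuous_pt. exists 0. apply is_derive_Reals, Hd, Hs; lra.
  - lra.
Qed.

(** The chain [H] lists a function and its successive derivatives explicitly. The induction
    hypothesis for the shifted chain bounds [H 1] from below; subtracting the primitive of that
    bound from [H 0] leaves a function with nonnegative derivative. *)
Lemma iterated_derivative_ge (n : nat) : forall (H : nat -> R -> R) (c d : R),
  (forall i, (i < n)%nat -> forall t, 0 <= t < d -> is_derive (H i) t (H (S i) t)) ->
  (forall i, (i < n)%nat -> H i 0 = 0) ->
  (forall t, 0 <= t < d -> c <= H n t) ->
  forall t, 0 <= t < d -> c * t ^ n / INR (fact n) <= H 0%nat t.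
Proof.
  induction n as [|n IH]; intros H c d Hd H0 Hc t Ht.
  - simpl. replace (c * 1 / 1) with c by field. now apply Hc.
  - assert (B : forall s, 0 <= s < d -> c * s ^ n / INR (fact n) <= H 1%nat s).
    { apply (IH (fun i => H (S i))).
      - intros i Hi. apply (Hd (S i)). lia.
      - intros i Hi. apply (H0 (S i)). lia.
      - exact Hc. }
    assert (L : H 0%nat 0 - c * 0 ^ S n / INR (fact (S n))
                <= H 0%nat t - c * t ^ S n / INR (fact (S n))).
    { apply (nonneg_derivative_le
        (fun s => H 0%nat s - c * s ^ S n / INR (fact (S n)))
        (fun s => H 1%nat s - c * s ^ n / INR (fact n)) d); [| |exact Ht].
      - intros s Hs. apply (is_derive_minus (H 0%nat)).
        + apply Hd; [lia|exact Hs].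
        + rewrite fact_simpl, mult_INR.
          assert (N : INR (S n) <> 0) by (apply not_0_INR; lia).
          pose proof (INR_fact_neq_0 n) as N'.
          auto_derive; [trivial|]. change (Init.Nat.pred (S n)) with n.
          field. now split.
      - intros s Hs. specialize (B s Hs). lra. }
    rewrite H0, pow_i in L by lia. unfold Rdiv in L at 1. lra.
Qed.

(** If [H k 0] were positive, continuity would keep [H k] above half that value, [c], near 0, and
    the Taylor bound would give [c t^k / k!] as a lower bound for [H 0]. The little-o hypothesis
    with tolerance [c / k!] contradicts this. Continuity of [H k] at 0 suffices, so the top order
    [k = n] is allowed. *)
Lemma iterated_derivative_nonpos (n k : nat) (H : nat -> R -> R) :
  (k <= n)%nat ->
  locally 0 (fun t => forall i, (i < n)%nat -> is_derive (H i) t (H (S i) t)) ->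
  continuous (H k) 0 ->
  is_lim (fun t => H 0%nat t / t ^ n) 0 0 ->
  (forall i, (i < k)%nat -> H i 0 = 0) ->
  H k 0 <= 0.
Proof.
  intros Hkn [d1 Hd] Hc Hl H0.
  destruct (Rle_or_lt (H k 0) 0) as [|P]; [assumption|exfalso].
  set (c := H k 0 / 2).
  assert (Pc : 0 < c) by (unfold c; lra).
  destruct (Hc (fun z => c < z)) as [d2 Hd2].
  { exists (mkposreal c Pc). intros z Hz.
    apply Rabs_def2 in Hz. unfold minus, plus, opp in Hz. simpl in Hz. unfold c in *. lra. }
  assert (Pe : 0 < c / INR (fact k)).
  { apply Rdiv_lt_0_compat; [exact Pc|apply INR_fact_lt_0]. }
  apply is_lim_spec in Hl. destruct (Hl (mkposreal _ Pe)) as [d3 Hd3].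
  set (d := Rmin (Rmin d1 d2) d3).
  assert (Pd : 0 < d).
  { unfold d. repeat apply Rmin_pos; apply cond_pos. }
  assert (d <= d1 /\ d <= d2 /\ d <= d3) as [L1 [L2 L3]].
  { unfold d. pose proof (Rmin_l (Rmin d1 d2) d3). pose proof (Rmin_r (Rmin d1 d2) d3).
    pose proof (Rmin_l d1 d2). pose proof (Rmin_r d1 d2). lra. }
  assert (Bd : forall s e, Rabs s < e -> ball 0 e s).
  { intros s e Hs. unfold ball; simpl. unfold AbsRing_ball, minus, plus, opp, abs; simpl.
    now replace (s + - 0) with s by ring. }
  (* The cap at 1 gives [t ^ n <= t ^ k], which makes the two bounds comparable. *)
  set (t := Rmin (d / 2) 1).
  assert (0 < t /\ t < d /\ t <= 1) as [T1 [T2 T3]].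
  { unfold t. pose proof (Rmin_l (d/2) 1). pose proof (Rmin_r (d/2) 1).
    assert (0 < Rmin (d/2) 1) by (apply Rmin_pos; lra). lra. }
  assert (A : c * t ^ k / INR (fact k) <= H 0%nat t).
  { apply (iterated_derivative_ge k H c d).
    - intros i Hi s Hs. apply Hd; [|lia]. apply Bd. rewrite Rabs_pos_eq; lra.
    - exact H0.
    - intros s Hs. left. apply Hd2. apply Bd. rewrite Rabs_pos_eq; lra.
    - lra. }
  specialize (Hd3 t). simpl in Hd3.
  assert (B : Rabs (H 0%nat t / t ^ n - 0) < c / INR (fact k)).
  { apply Hd3; [|lra]. apply Bd. rewrite Rabs_pos_eq; lra. }
  apply Rabs_def2 in B. destruct B as [B _].
  assert (Pn : 0 < t ^ n) by (apply pow_lt; lra).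
  assert (H 0%nat t < c / INR (fact k) * t ^ n).
  { apply (Rmult_lt_compat_r (t ^ n)) in B; [|exact Pn].
    replace ((H 0%nat t / t ^ n - 0) * t ^ n) with (H 0%nat t) in B; [exact B|field; lra]. }
  assert (t ^ n <= t ^ k).
  { replace n with (k + (n - k))%nat by lia. rewrite pow_add.
    rewrite <- (Rmult_1_r (t ^ k)) at 2. apply Rmult_le_compat_l; [apply pow_le; lra|].
    rewrite <- (pow1 (n - k)). apply pow_incr; lra. }
  assert (c / INR (fact k) * t ^ n <= c / INR (fact k) * t ^ k)
    by (apply Rmult_le_compat_l; lra).
  unfold Rdiv in *. lra.
Qed.

(** Strong induction on [k]: once the lower derivatives vanish, the one-sided bound applied to [H]
    and to [- H] squeezes [H k 0]. *)
Lemma little_o_derivatives_zero (n : nat) (H : nat -> R -> R) :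
  locally 0 (fun t => forall i, (i < n)%nat -> is_derive (H i) t (H (S i) t)) ->
  (forall k, (k <= n)%nat -> continuous (H k) 0) ->
  is_lim (fun t => H 0%nat t / t ^ n) 0 0 ->
  forall k, (k <= n)%nat -> H k 0 = 0.
Proof.
  intros Hd Hc Hl k.
  induction k as [k IH] using (well_founded_induction Wf_nat.lt_wf). intros Hk.
  assert (H0 : forall i, (i < k)%nat -> H i 0 = 0) by (intros; apply IH; lia).
  apply Rle_antisym.
  - apply (iterated_derivative_nonpos n); auto.
  - apply Ropp_le_cancel. rewrite Ropp_0.
    apply (iterated_derivative_nonpos n k (fun i t => - H i t)); auto.
    + apply filter_imp with (2 := Hd). intros t Ht i Hi.
      apply (is_derive_opp (H i)), Ht, Hi.
    + apply (continuous_opp (H k)), Hc, Hk.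
    + apply is_lim_ext with (fun t => - (H 0%nat t / t ^ n)).
      * intros t. unfold Rdiv. ring.
      * pose proof (is_lim_opp _ _ _ Hl) as L.
        replace (Rbar_opp 0) with (Finite 0) in L by (simpl; f_equal; ring).
        exact L.
    + intros i Hi. rewrite H0 by exact Hi. ring.
Qed.

(** The function [q^2 exp(-2Mt)] is nonnegative, nonincreasing and starts at 0. *)
Lemma gronwall_zero_right (q h : R -> R) (M d : R) :
  (forall t, 0 <= t < d -> is_derive q t (h t)) ->
  (forall t, 0 <= t < d -> q t * h t <= M * (q t * q t)) ->
  q 0 = 0 -> forall t, 0 <= t < d -> q t = 0.
Proof.
  intros Hd Hm H0 t Ht.
  assert (L : - (q 0 * q 0 * exp (- (2 * M * 0))) <= - (q t * q t * exp (- (2 * M * t)))).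
  { apply (nonneg_derivative_le
      (fun s => - (q s * q s * exp (- (2 * M * s))))
      (fun s => 2 * exp (- (2 * M * s)) * (M * (q s * q s) - q s * h s)) d); [| |exact Ht].
    - intros s Hs. pose proof (Hd s Hs) as E. auto_derive.
      + repeat split; exists (h s); exact E.
      + rewrite (is_derive_unique (fun z : R => q z) s _ E). ring.
    - intros s Hs. specialize (Hm s Hs).
      apply Rmult_le_pos; [|lra]. pose proof (exp_pos (- (2 * M * s))). lra. }
  rewrite H0 in L. pose proof (exp_pos (- (2 * M * t))) as P.
  apply Rsqr_0_uniq, Rle_antisym; [|apply Rle_0_sqr].
  apply (Rmult_le_reg_r (exp (- (2 * M * t)))); [exact P|]. unfold Rsqr. lra.
Qed.

Lemma gronwall_zero (q h : R -> R) (M d : R) :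
  (forall t, Rabs t < d -> is_derive q t (h t)) ->
  (forall t, Rabs t < d -> Rabs (h t) <= M * Rabs (q t)) ->
  q 0 = 0 -> forall t, Rabs t < d -> q t = 0.
Proof.
  intros Hd Hm H0.
  assert (B : forall t, Rabs t < d -> Rabs (q t * h t) <= M * (q t * q t)).
  { intros t Ht. rewrite Rabs_mult.
    replace (q t * q t) with (Rabs (q t) * Rabs (q t))
      by (rewrite <- Rabs_mult; apply Rabs_pos_eq, Rle_0_sqr).
    pose proof (Rmult_le_compat_l _ _ _ (Rabs_pos (q t)) (Hm t Ht)). lra. }
  intros t Ht. destruct (Rle_or_lt 0 t) as [P|P].
  - apply (gronwall_zero_right q h M d); auto.
    + intros s Hs. apply Hd. rewrite Rabs_pos_eq; lra.
    + intros s Hs. eapply Rle_trans; [apply Rle_abs|apply B]. rewrite Rabs_pos_eq; lra.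
    + rewrite Rabs_pos_eq in Ht; lra.
  (* Negative times are reflected to positive ones; the bound on [Rabs (q t * h t)] survives the
     change of sign of the derivative. *)
  - replace t with (- (- t)) by ring.
    apply (gronwall_zero_right (fun s => q (- s)) (fun s => - h (- s)) M d).
    + intros s Hs. replace (- h (- s)) with (scal (-1) (h (- s))) by (change (-1 * h (- s) = - h (- s)); ring).
      apply (is_derive_comp q Ropp).
      * apply Hd. rewrite Rabs_Ropp, Rabs_pos_eq; lra.
      * auto_derive; [trivial|ring].
    + intros s Hs. specialize (B (- s)).
      eapply Rle_trans; [|apply B].
      * rewrite <- Rabs_Ropp. eapply Rle_trans; [|apply Rle_abs]. right; ring.
      * rewrite Rabs_Ropp, Rabs_pos_eq; lra.
    + now rewrite Ropp_0.
    + rewrite Rabs_left in Ht by exact P. lra.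
Qed.

Lemma locally_0_iff (P : R -> Prop) :
  locally 0 P <-> exists d, 0 < d /\ forall t, Rabs t < d -> P t.
Proof.
  assert (E : forall t : R, minus t 0 = t) by (intros t; exact (Rminus_0_r t)).
  split.
  - intros [d Hd]. exists d. split; [apply cond_pos|]. intros t Ht. apply Hd.
    unfold ball; simpl; unfold AbsRing_ball. now rewrite E.
  - intros [d [Pd Hd]]. exists (mkposreal d Pd). intros t Ht. apply Hd.
    unfold ball in Ht; simpl in Ht; unfold AbsRing_ball in Ht. now rewrite E in Ht.
Qed.

Lemma continuous_0_lt_locally (g : R -> R) (c : R) :
  continuous g 0 -> g 0 < c -> locally 0 (fun t => g t < c).
Proof.
  intros Hg Hc. apply (Hg (fun z => z < c)). now apply open_lt.
Qed.

(* [q' = (w / det) q], with a coefficient bounded near 0. *)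
Lemma linear_ode_zero (q h w det : R -> R) :
  locally 0 (fun t => is_derive q t (h t)) ->
  locally 0 (fun t => h t * det t = w t * q t) ->
  continuous w 0 -> continuous det 0 -> det 0 <> 0 -> q 0 = 0 ->
  locally 0 (fun t => q t = 0).
Proof.
  intros Hd He Hw Hdet Hn H0.
  assert (Hm : continuous (fun t => Rabs (w t / det t)) 0).
  { apply (continuous_comp (fun t => w t / det t) Rabs); [|apply continuous_Rabs].
    apply (continuous_mult w (fun t => / det t)); [exact Hw|].
    now apply continuous_Rinv_comp. }
  set (M := Rabs (w 0 / det 0) + 1).
  assert (HM := continuous_0_lt_locally _ M Hm ltac:(unfold M; lra)).
  assert (HN : locally 0 (fun t => det t <> 0)).
  { apply (Hdet (fun z => z <> 0)). now apply open_neq. }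
  pose proof (filter_and _ _ Hd (filter_and _ _ He (filter_and _ _ HM HN))) as HA.
  apply locally_0_iff in HA. destruct HA as [d [Pd HA]].
  apply locally_0_iff. exists d. split; [exact Pd|].
  apply (gronwall_zero q h M d); [| |exact H0].
  - intros t Ht. apply (HA t Ht).
  - intros t Ht. destruct (HA t Ht) as [_ [E [L N]]].
    replace (h t) with (w t / det t * q t).
    + rewrite Rabs_mult. apply Rmult_le_compat_r; [apply Rabs_pos|lra].
    + apply (Rmult_eq_reg_r (det t)); [|exact N]. rewrite E. field. exact N.
Qed.

(** The energy [h1^2 + h2^2] is conserved and starts at 0, so [h1] vanishes and [h0] is constant. *)
Lemma zero_of_third_order_ode (h0 h1 h2 : R -> R) :
  locally 0 (fun t => is_derive h0 t (h1 t)) ->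
  locally 0 (fun t => is_derive h1 t (h2 t)) ->
  locally 0 (fun t => is_derive h2 t (- h1 t)) ->
  h0 0 = 0 -> h1 0 = 0 -> h2 0 = 0 ->
  locally 0 (fun t => h0 t = 0).
Proof.
  intros A0 A1 A2 E0 E1 E2.
  pose proof (filter_and _ _ A0 (filter_and _ _ A1 A2)) as HA.
  apply locally_0_iff in HA. destruct HA as [d [Pd HA]].
  apply locally_0_iff. exists d. split; [exact Pd|].
  assert (Z : forall t, Rabs t < d -> h1 t * h1 t + h2 t * h2 t = 0).
  { intros t Ht. replace 0 with (h1 0 * h1 0 + h2 0 * h2 0) at 1 by (rewrite E1, E2; ring).
    apply (zero_derivative_eq (fun s => h1 s * h1 s + h2 s * h2 s) d); [|exact Ht].
    intros s Hs. destruct (HA s Hs) as [_ [B1 B2]]. auto_derive.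
    - repeat split; solve [exists (h2 s); exact B1 | exists (- h1 s); exact B2].
    - rewrite (is_derive_unique (fun z : R => h1 z) s _ B1),
        (is_derive_unique (fun z : R => h2 z) s _ B2). ring. }
  intros t Ht. rewrite <- E0. apply (zero_derivative_eq h0 d); [|exact Ht].
  intros s Hs. destruct (HA s Hs) as [B0 _].
  replace 0 with (h1 s); [exact B0|]. specialize (Z s Hs). nra.
Qed.

(** * The projected circle *)

(** Inverting [acos] requires the dot product to lie in [-1, 1]. This is Cauchy-Schwarz, obtained
    from Lagrange's identity with the cross product. *)
Lemma dot3_of_spherical_dist (p q : point3) (rho : R) :
  on_sphere p -> on_sphere q -> spherical_dist p q = rho -> dot3 p q = cos rho.
Proof.
  destruct p as [[p1 p2] p3], q as [[q1 q2] q3].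
  unfold on_sphere, spherical_dist; simpl. intros Hp Hq <-.
  symmetry. apply cos_acos. set (d := p1 * q1 + p2 * q2 + p3 * q3).
  assert (L : d * d <= 1).
  { assert (E : (p1 * q1 + p2 * q2 + p3 * q3) * (p1 * q1 + p2 * q2 + p3 * q3)
       + ((p1 * q2 - p2 * q1) * (p1 * q2 - p2 * q1)
          + (p1 * q3 - p3 * q1) * (p1 * q3 - p3 * q1)
          + (p2 * q3 - p3 * q2) * (p2 * q3 - p3 * q2))
       = (p1 * p1 + p2 * p2 + p3 * p3) * (q1 * q1 + q2 * q2 + q3 * q3)) by ring.
    rewrite Hp, Hq in E. fold d in E.
    pose proof (Rle_0_sqr (p1 * q2 - p2 * q1)).
    pose proof (Rle_0_sqr (p1 * q3 - p3 * q1)).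
    pose proof (Rle_0_sqr (p2 * q3 - p3 * q2)). unfold Rsqr in *. lra. }
  nra.
Qed.

(** Equation of the stereographic image of a plane section of the sphere: a circle if [s + c3] is
    nonzero, otherwise a line or a degenerate case. It follows from
    [X^2 + Y^2 = (1 - n3) / (n3 + 1)]. *)
Lemma circle_point_equation (c1 c2 c3 n1 n2 n3 s : R) :
  n1 * n1 + n2 * n2 + n3 * n3 = 1 -> n3 + 1 <> 0 ->
  c1 * n1 + c2 * n2 + c3 * n3 = s ->
  let X := n1 / (n3 + 1) in
  let Y := n2 / (n3 + 1) in
  (s + c3) * (X ^ 2 + Y ^ 2) - 2 * c1 * X - 2 * c2 * Y + (s - c3) = 0.
Proof.
  intros Hn H0 <- X Y.
  assert (E : X ^ 2 + Y ^ 2 = (1 - n3) / (n3 + 1)).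
  { unfold X, Y. replace ((n1 / (n3 + 1)) ^ 2 + (n2 / (n3 + 1)) ^ 2)
      with ((n1 * n1 + n2 * n2) / ((n3 + 1) * (n3 + 1))) by (field; exact H0).
    replace (n1 * n1 + n2 * n2) with ((1 - n3) * (n3 + 1)) by (ring_simplify; lra).
    field. exact H0. }
  rewrite E. unfold X, Y. field. exact H0.
Qed.

(** Three sample points 0, [e], [-e] suffice: with [0 < e <= 1 < PI / 2], both [sin e] and
    [1 - cos e] are positive. *)
Lemma affine_sine_cosine_zero (p q r t0 t1 : R) :
  t0 < 0 < t1 ->
  (forall t, t0 <= t <= t1 -> p + q * sin t + r * cos t = 0) ->
  p = 0 /\ q = 0 /\ r = 0.
Proof.
  intros Ht H.
  set (e := Rmin 1 (Rmin (- t0) t1)).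
  assert (0 < e /\ e <= 1 /\ e <= - t0 /\ e <= t1) as [E0 [E1 [E2 E3]]].
  { unfold e. pose proof (Rmin_l 1 (Rmin (- t0) t1)). pose proof (Rmin_r 1 (Rmin (- t0) t1)).
    pose proof (Rmin_l (- t0) t1). pose proof (Rmin_r (- t0) t1).
    assert (0 < Rmin 1 (Rmin (- t0) t1)) by (repeat apply Rmin_pos; lra). lra. }
  pose proof (H 0 ltac:(lra)) as H0. pose proof (H e ltac:(lra)) as H1.
  pose proof (H (- e) ltac:(lra)) as H2.
  rewrite sin_0, cos_0 in H0. rewrite sin_neg, cos_neg in H2.
  pose proof PI2_1.
  assert (S : 0 < sin e) by (apply sin_gt_0; lra).
  assert (C : cos e < 1).
  { rewrite <- cos_0. apply cos_decreasing_1; lra. }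
  assert (q = 0) by nra. assert (r = 0) by nra. lra.
Qed.

(** The top-view circle and the projected spherical circle share an arc, so their equations are
    proportional. Comparing coefficients and using that the spherical center is a unit vector gives
    [s (k + 1) = 2 sin theta] and [s^2 (u^2 + v^2) = cos^2 theta]; eliminating [s] yields the
    polynomial. *)
Lemma top_view_poly_of_projected_arc (theta x y u v : R) :
  0 < theta < PI / 2 ->
  0 < u ^ 2 + v ^ 2 ->
  top_view_is_projected_arc (PI / 2 - theta) x y u v ->
  top_view_poly theta x y u v = 0.
Proof.
  intros Hth Hr (t0 & t1 & A & Ht & (c & gamma & Hc & _ & Hg & _ & HA) & HS & Hq).
  destruct c as [[c1 c2] c3].
  assert (Hpt : forall t, t0 <= t <= t1 ->
    let X := conic_x x u v t in let Y := conic_y y u v t in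
    (sin theta + c3) * (X ^ 2 + Y ^ 2) - 2 * c1 * X - 2 * c2 * Y + (sin theta - c3) = 0).
  { intros t Hti.
    destruct (proj1 (Hq (conic_x x u v t, conic_y y u v t))) as [p [Ap Ep]].
    { now exists t. }
    destruct (proj1 (HA p) Ap) as [s [Hs Es]].
    destruct (Hg s Hs) as [Sp Dp]. rewrite Es in Sp, Dp.
    pose proof (dot3_of_spherical_dist _ _ _ Hc Sp Dp) as Dc.
    rewrite cos_shift in Dc.
    destruct p as [[n1 n2] n3]. unfold on_sphere in Sp. simpl in Sp, Dc, Ep.
    assert (n3 + 1 <> 0).
    { intros E. apply HS. unfold south_pole.
      assert (n3 = -1) by lra. subst n3.
      assert (n1 = 0) by nra. assert (n2 = 0) by nra. now subst. }
    injection Ep as EX EY.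
    pose proof (circle_point_equation c1 c2 c3 n1 n2 n3 (sin theta) Sp H Dc) as Q.
    cbv zeta in Q. rewrite <- EX, <- EY in Q. exact Q. }
  set (s := sin theta + c3) in *.
  (* The power of the origin: the top-view circle is [X^2 + Y^2 - 2 (x+u) X - 2 (y+v) Y + k = 0]. *)
  set (k := x ^ 2 + y ^ 2 + 2 * x * u + 2 * y * v).
  (* Subtracting [s] times the equation of the top-view circle leaves an affine
     form vanishing on a nondegenerate arc. *)
  set (p := 2 * (s * (x + u) - c1)). set (q := 2 * (s * (y + v) - c2)).
  set (m := sin theta - c3 - s * k).
  destruct (affine_sine_cosine_zero (m + p * (x + u) + q * (y + v))
    (p * v - q * u) (- (p * u + q * v)) t0 t1 Ht) as [E1 [E2 E3]].
  { intros t Hti. rewrite <- (Hpt t Hti). unfold m, p, q, k, conic_x, conic_y.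
    pose proof (sin2_cos2 t) as T. unfold Rsqr in T.
    assert (K : sin t ^ 2 = 1 - cos t ^ 2) by (simpl; lra).
    ring_simplify. rewrite K. ring. }
  (* The two vanishing combinations are the components of [(p, q)] along [(v, -u)] and [(u, v)], up
     to sign and scale; these vectors form an orthogonal basis. *)
  assert (P0 : p = 0).
  { apply (Rmult_eq_reg_r (u ^ 2 + v ^ 2)); [|lra].
    transitivity (v * (p * v - q * u) - u * - (p * u + q * v)); [ring|].
    rewrite E2, E3; ring. }
  assert (Q0 : q = 0).
  { apply (Rmult_eq_reg_r (u ^ 2 + v ^ 2)); [|lra].
    transitivity (- u * (p * v - q * u) - v * - (p * u + q * v)); [ring|].
    rewrite E2, E3; ring. }
  rewrite P0, Q0 in E1. unfold on_sphere in Hc; simpl in Hc.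
  assert (C1 : c1 = s * (x + u)) by (unfold p in P0; lra).
  assert (C2 : c2 = s * (y + v)) by (unfold q in Q0; lra).
  assert (C3 : c3 = s - sin theta) by (unfold s; ring).
  assert (K : s * (k + 1) = 2 * sin theta) by (unfold m in E1; lra).
  assert (Sp : 0 < sin theta) by (apply sin_gt_0; lra).
  assert (Cp : 0 < cos theta) by (apply cos_gt_0; lra).
  assert (T : sin theta ^ 2 = 1 - cos theta ^ 2).
  { pose proof (sin2_cos2 theta) as T. unfold Rsqr in T. simpl. lra. }
  assert (Rr : s ^ 2 * (u ^ 2 + v ^ 2) = cos theta ^ 2).
  { assert (E : s ^ 2 * (u ^ 2 + v ^ 2) = c1 * c1 + c2 * c2 - s * (s * (k + 1)) + s ^ 2).
    { rewrite C1, C2. unfold k. ring. }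
    rewrite E, K. replace (c1 * c1 + c2 * c2) with (1 - c3 * c3) by lra.
    rewrite C3. ring_simplify. lra. }
  (* If [s] were 0, [K] would force [sin theta = 0]: the image is never a line here. *)
  assert (s <> 0) by (intros ->; lra).
  apply (Rmult_eq_reg_l (s ^ 2)); [|now apply pow_nonzero].
  unfold top_view_poly.
  transitivity ((s * (k + 1)) ^ 2 - 4 * tan theta ^ 2 * (s ^ 2 * (u ^ 2 + v ^ 2))).
  { unfold k. ring. }
  rewrite K, Rr. unfold tan. field. lra.
Qed.

(** * Differentiation along the top-view circle *)

(** Single-step partials follow the recursion of [ex_diff_n]; iterated with [D2] innermost, they are
    convertible to [partial_derive]. *)
Definition D1 (f : R -> R -> R) (x y : R) : R := Derive (fun s => f s y) x.
Definition D2 (f : R -> R -> R) (x y : R) : R := Derive (fun s => f x s) y.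

Definition open_2d (D : R -> R -> Prop) : Prop :=
  forall x y, D x y -> locally_2d D x y.

Lemma in_disk_open (x0 y0 r : R) : open_2d (in_disk x0 y0 r).
Proof.
  intros x y H. unfold in_disk in H.
  set (F := fun x y : R => (x - x0) * (x - x0) + (y - y0) * (y - y0)).
  assert (C : continuity_2d_pt F x y).
  { apply continuity_2d_pt_plus; apply continuity_2d_pt_mult; apply continuity_2d_pt_minus;
      first [apply continuity_2d_pt_id1 | apply continuity_2d_pt_id2
            | apply continuity_2d_pt_const]. }
  assert (P : 0 < r ^ 2 - F x y) by (unfold F; simpl in *; lra).
  apply locally_2d_impl with (2 := C (mkposreal _ P)).
  apply locally_2d_forall. intros s t L. apply Rabs_def2 in L.
  unfold in_disk. unfold F in *; simpl in *; lra.
Qed.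

Lemma Cn_in_continuous (D : R -> R -> Prop) (n : nat) (f : R -> R -> R) :
  Cn_in D n f -> continuous_in D f.
Proof. intros H x y Hxy. specialize (H x y Hxy). destruct n; apply H. Qed.

Lemma Cn_in_le (D : R -> R -> Prop) (m n : nat) (f : R -> R -> R) :
  (m <= n)%nat -> Cn_in D n f -> Cn_in D m f.
Proof. intros Hmn Hf x y Hxy. now apply (ex_diff_n_m n m Hmn), Hf. Qed.

Lemma Cn_in_D1 (D : R -> R -> Prop) (n : nat) (f : R -> R -> R) :
  Cn_in D (S n) f -> Cn_in D n (D1 f).
Proof. intros H x y Hxy. apply (H x y Hxy). Qed.

Lemma Cn_in_D2 (D : R -> R -> Prop) (n : nat) (f : R -> R -> R) :
  Cn_in D (S n) f -> Cn_in D n (D2 f).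
Proof. intros H x y Hxy. apply (H x y Hxy). Qed.

(** Joint differentiability follows from one partial existing nearby and being continuous at the
    point, together with existence of the other at the point. *)
Lemma Cn_in_differentiable (D : R -> R -> Prop) (n : nat) (f : R -> R -> R) (x y : R) :
  open_2d D -> Cn_in D (S n) f -> D x y ->
  differentiable_pt_lim f x y (D1 f x y) (D2 f x y).
Proof.
  intros HD Hf Hxy. apply filterdiff_differentiable_pt_lim.
  apply (is_derive_filterdiff f x y (D1 f) (D2 f x y)).
  - apply filter_imp with (2 := proj1 (locally_2d_locally _ _ _) (HD x y Hxy)).
    intros z Hz. apply Derive_correct, (Hf _ _ Hz).
  - apply Derive_correct, (Hf x y Hxy).
  - apply (continuity_2d_pt_filterlim (D1 f)), (Cn_in_continuous D n (D1 f)); [|exact Hxy].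
    now apply Cn_in_D1.
Qed.

Lemma Cn_in_Schwarz (D : R -> R -> Prop) (n : nat) (f : R -> R -> R) (x y : R) :
  open_2d D -> Cn_in D (S (S n)) f -> D x y -> D2 (D1 f) x y = D1 (D2 f) x y.
Proof.
  intros HD Hf Hxy. symmetry. apply Schwarz.
  - apply locally_2d_impl with (2 := HD x y Hxy). apply locally_2d_forall.
    intros s t Hst. destruct (Hf s t Hst) as [_ [A1 [A2 [A3 A4]]]].
    repeat split; [exact A1|exact A2|apply A4|apply A3].
  - apply (Cn_in_continuous D n (D1 (D2 f))); [|exact Hxy]. now apply Cn_in_D1, Cn_in_D2.
  - apply (Cn_in_continuous D n (D2 (D1 f))); [|exact Hxy]. now apply Cn_in_D2, Cn_in_D1.
Qed.

(** Allows the symmetry of second derivatives, known only on [D], to be differentiated once more. *)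
Lemma D1_ext_in (D : R -> R -> Prop) (f g : R -> R -> R) (x y : R) :
  open_2d D -> (forall s t, D s t -> f s t = g s t) -> D x y -> D1 f x y = D1 g x y.
Proof.
  intros HD E Hxy. apply Derive_ext_loc.
  apply filter_imp with (2 := locally_2d_1d_const_y _ _ _ (HD x y Hxy)).
  intros s Hs. now apply E.
Qed.

Lemma continuous_along (F : R -> R -> R) (X Y : R -> R) (t : R) :
  continuous X t -> continuous Y t -> continuity_2d_pt F (X t) (Y t) ->
  continuous (fun s => F (X s) (Y s)) t.
Proof.
  intros HX HY HF. apply continuity_2d_pt_filterlim in HF.
  apply (continuous_comp_2 X Y F); assumption.
Qed.

(** Derivative of [F] along the circle, on which [x' = v] and [y' = -u]. *)
Definition along (F : R -> R -> R) (x y u v : R) : R := D1 F x y * v - D2 F x y * u.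

Lemma is_derive_along (D : R -> R -> Prop) (n : nat) (F : R -> R -> R)
    (X Y : R -> R) (t u v : R) :
  open_2d D -> Cn_in D (S n) F -> D (X t) (Y t) ->
  is_derive X t v -> is_derive Y t (- u) ->
  is_derive (fun s => F (X s) (Y s)) t (along F (X t) (Y t) u v).
Proof.
  intros HD HF Hxy HX HY.
  replace (along F (X t) (Y t) u v)
    with (D1 F (X t) (Y t) * v + D2 F (X t) (Y t) * - u) by (unfold along; ring).
  apply is_derive_Reals, derivable_pt_lim_comp_2d.
  - now apply (Cn_in_differentiable D n).
  - now apply is_derive_Reals.
  - now apply is_derive_Reals.
Qed.

(** The shape of [contact_poly] with free coefficients; [k] stands for [f_xx - f_yy] and [m] for
    [f_xy]. The same shape serves for the differentiated coefficients in [contact_poly']. *)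
Definition cubic (p q r s k m u v : R) : R :=
  p * v ^ 3 - 3 * q * v ^ 2 * u + 3 * r * v * u ^ 2 - s * u ^ 3
  + 3 * k * u * v + 3 * m * (v ^ 2 - u ^ 2).

(* Divided differences: [cubic] changes by [slope_u * du + slope_v * dv]; on the
   diagonal they are the partial derivatives. *)
Definition cubic_slope_u (q r s k m u1 v1 u2 v2 : R) : R :=
  - 3 * q * v1 ^ 2 + 3 * r * v2 * (u1 + u2) - s * (u1 ^ 2 + u1 * u2 + u2 ^ 2)
  + 3 * k * v1 - 3 * m * (u1 + u2).
Definition cubic_slope_v (p q r k m u1 v1 u2 v2 : R) : R :=
  p * (v1 ^ 2 + v1 * v2 + v2 ^ 2) - 3 * q * u2 * (v1 + v2) + 3 * r * u1 ^ 2
  + 3 * k * u2 + 3 * m * (v1 + v2).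

Lemma cubic_difference (p q r s k m u1 v1 u2 v2 : R) :
  cubic p q r s k m u1 v1 - cubic p q r s k m u2 v2 =
  cubic_slope_u q r s k m u1 v1 u2 v2 * (u1 - u2)
  + cubic_slope_v p q r k m u1 v1 u2 v2 * (v1 - v2).
Proof. unfold cubic, cubic_slope_u, cubic_slope_v. ring. Qed.

Lemma contact_poly_cubic (f : R -> R -> R) (x y u v : R) :
  contact_poly f x y u v =
  cubic (D1 (D1 (D1 f)) x y) (D1 (D1 (D2 f)) x y) (D1 (D2 (D2 f)) x y)
    (D2 (D2 (D2 f)) x y) (D1 (D1 f) x y - D2 (D2 f) x y) (D1 (D2 f) x y) u v.
Proof. reflexivity. Qed.

(** The derivative of [contact_poly] along the circle, on which also [u' = -v], [v' = u]. *)
Definition contact_poly' (f : R -> R -> R) (x y u v : R) : R :=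
  cubic (along (D1 (D1 (D1 f))) x y u v) (along (D1 (D1 (D2 f))) x y u v)
    (along (D1 (D2 (D2 f))) x y u v) (along (D2 (D2 (D2 f))) x y u v)
    (along (D1 (D1 f)) x y u v - along (D2 (D2 f)) x y u v)
    (along (D1 (D2 f)) x y u v) u v
  - cubic_slope_u (D1 (D1 (D2 f)) x y) (D1 (D2 (D2 f)) x y)
    (D2 (D2 (D2 f)) x y) (D1 (D1 f) x y - D2 (D2 f) x y) (D1 (D2 f) x y) u v u v * v
  + cubic_slope_v (D1 (D1 (D1 f)) x y) (D1 (D1 (D2 f)) x y) (D1 (D2 (D2 f)) x y)
    (D1 (D1 f) x y - D2 (D2 f) x y) (D1 (D2 f) x y) u v u v * u.

(** The second derivative of [f] along the motion; the first-order terms come from [x'' = u],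
    [y'' = v]. *)
Definition second_along (f : R -> R -> R) (x y u v : R) : R :=
  D1 (D1 f) x y * v ^ 2 - 2 * D1 (D2 f) x y * u * v + D2 (D2 f) x y * u ^ 2
  + D1 f x y * u + D2 f x y * v.

Lemma is_derive_cubic (p q r s k m U V : R -> R) (t p' q' r' s' k' m' : R) :
  is_derive p t p' -> is_derive q t q' -> is_derive r t r' -> is_derive s t s' ->
  is_derive k t k' -> is_derive m t m' ->
  is_derive U t (- V t) -> is_derive V t (U t) ->
  is_derive (fun z => cubic (p z) (q z) (r z) (s z) (k z) (m z) (U z) (V z)) t
    (cubic p' q' r' s' k' m' (U t) (V t)
     - cubic_slope_u (q t) (r t) (s t) (k t) (m t) (U t) (V t) (U t) (V t) * V t
     + cubic_slope_v (p t) (q t) (r t) (k t) (m t) (U t) (V t) (U t) (V t) * U t).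
Proof.
  intros Hp Hq Hr Hs Hk Hm HU HV. unfold cubic, cubic_slope_u, cubic_slope_v.
  auto_derive.
  - repeat split; eexists; eassumption.
  - rewrite (is_derive_unique (fun z : R => p z) t _ Hp),
      (is_derive_unique (fun z : R => q z) t _ Hq),
      (is_derive_unique (fun z : R => r z) t _ Hr),
      (is_derive_unique (fun z : R => s z) t _ Hs),
      (is_derive_unique (fun z : R => k z) t _ Hk),
      (is_derive_unique (fun z : R => m z) t _ Hm),
      (is_derive_unique (fun z : R => U z) t _ HU),
      (is_derive_unique (fun z : R => V z) t _ HV). ring.
Qed.

Lemma is_derive_contact_poly (D : R -> R -> Prop) (f : R -> R -> R) (X Y U V : R -> R) (t : R) :
  open_2d D -> Cn_in D 4 f -> D (X t) (Y t) ->
  is_derive X t (V t) -> is_derive Y t (- U t) ->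
  is_derive U t (- V t) -> is_derive V t (U t) ->
  is_derive (fun s => contact_poly f (X s) (Y s) (U s) (V s)) t
    (contact_poly' f (X t) (Y t) (U t) (V t)).
Proof.
  intros HD Hf Hxy HX HY HU HV.
  apply (is_derive_cubic (fun z => D1 (D1 (D1 f)) (X z) (Y z))
    (fun z => D1 (D1 (D2 f)) (X z) (Y z)) (fun z => D1 (D2 (D2 f)) (X z) (Y z))
    (fun z => D2 (D2 (D2 f)) (X z) (Y z))
    (fun z => D1 (D1 f) (X z) (Y z) - D2 (D2 f) (X z) (Y z))
    (fun z => D1 (D2 f) (X z) (Y z))); try assumption.
  5: apply (is_derive_minus (fun z => D1 (D1 f) (X z) (Y z)) (fun z => D2 (D2 f) (X z) (Y z))).
  all: eapply (is_derive_along D); try eassumption; repeat (apply Cn_in_D1 || apply Cn_in_D2);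
    exact Hf.
Qed.

Lemma is_derive_first_along (D : R -> R -> Prop) (f : R -> R -> R) (X Y U V : R -> R) (t : R) :
  open_2d D -> Cn_in D 2 f -> D (X t) (Y t) ->
  is_derive X t (V t) -> is_derive Y t (- U t) ->
  is_derive U t (- V t) -> is_derive V t (U t) ->
  is_derive (fun s => along f (X s) (Y s) (U s) (V s)) t
    (second_along f (X t) (Y t) (U t) (V t)).
Proof.
  intros HD Hf Hxy HX HY HU HV.
  assert (H1 : is_derive (fun s => D1 f (X s) (Y s)) t (along (D1 f) (X t) (Y t) (U t) (V t))).
  { apply (is_derive_along D 0); try assumption. now apply Cn_in_D1. }
  assert (H2 : is_derive (fun s => D2 f (X s) (Y s)) t (along (D2 f) (X t) (Y t) (U t) (V t))).
  { apply (is_derive_along D 0); try assumption. now apply Cn_in_D2. }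
  unfold along at 1. set (a := fun s => D1 f (X s) (Y s)) in *.
  set (b := fun s => D2 f (X s) (Y s)) in *.
  change (is_derive (fun s => a s * V s - b s * U s) t
    (second_along f (X t) (Y t) (U t) (V t))).
  auto_derive.
  - repeat split; eexists; eassumption.
  - rewrite (is_derive_unique (fun z : R => a z) t _ H1),
      (is_derive_unique (fun z : R => b z) t _ H2),
      (is_derive_unique (fun z : R => U z) t _ HU),
      (is_derive_unique (fun z : R => V z) t _ HV).
    unfold along, second_along, a, b. rewrite (Cn_in_Schwarz D 0) by assumption. ring.
Qed.

(** This is [g''' = q - g']: since [x''' = -x'] and [y''' = -y'], the terms with first derivatives
    of [f] add up to [-g'], and all the others form [contact_poly]. *)
Lemma is_derive_second_along (D : R -> R -> Prop) (f : R -> R -> R) (X Y U V : R -> R) (t : R) :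
  open_2d D -> Cn_in D 3 f -> D (X t) (Y t) ->
  is_derive X t (V t) -> is_derive Y t (- U t) ->
  is_derive U t (- V t) -> is_derive V t (U t) ->
  is_derive (fun s => second_along f (X s) (Y s) (U s) (V s)) t
    (contact_poly f (X t) (Y t) (U t) (V t) - along f (X t) (Y t) (U t) (V t)).
Proof.
  intros HD Hf Hxy HX HY HU HV.
  assert (Ha : forall n F, Cn_in D (S n) F ->
    is_derive (fun s => F (X s) (Y s)) t (along F (X t) (Y t) (U t) (V t))).
  { intros n F HF. now apply (is_derive_along D n). }
  pose proof (Ha 0%nat _ (Cn_in_D1 _ _ _ (Cn_in_D1 _ _ _ Hf))) as H11.
  pose proof (Ha 0%nat _ (Cn_in_D1 _ _ _ (Cn_in_D2 _ _ _ Hf))) as H12.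
  pose proof (Ha 0%nat _ (Cn_in_D2 _ _ _ (Cn_in_D2 _ _ _ Hf))) as H22.
  pose proof (Ha 1%nat _ (Cn_in_D1 _ _ _ Hf)) as H1.
  pose proof (Ha 1%nat _ (Cn_in_D2 _ _ _ Hf)) as H2.
  rewrite contact_poly_cubic.
  set (a := fun s => D1 (D1 f) (X s) (Y s)) in *.
  set (b := fun s => D1 (D2 f) (X s) (Y s)) in *.
  set (c := fun s => D2 (D2 f) (X s) (Y s)) in *.
  set (d := fun s => D1 f (X s) (Y s)) in *.
  set (e := fun s => D2 f (X s) (Y s)) in *.
  apply (is_derive_ext (fun s => a s * V s ^ 2 - 2 * b s * U s * V s + c s * U s ^ 2
    + d s * U s + e s * V s)); [reflexivity|].
  auto_derive.
  - repeat split; eexists; eassumption.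
  - rewrite (is_derive_unique (fun z : R => a z) t _ H11),
      (is_derive_unique (fun z : R => b z) t _ H12),
      (is_derive_unique (fun z : R => c z) t _ H22),
      (is_derive_unique (fun z : R => d z) t _ H1),
      (is_derive_unique (fun z : R => e z) t _ H2),
      (is_derive_unique (fun z : R => U z) t _ HU),
      (is_derive_unique (fun z : R => V z) t _ HV).
    assert (S0 : forall s t, D s t -> D2 (D1 f) s t = D1 (D2 f) s t).
    { intros. now apply (Cn_in_Schwarz D 1). }
    (* Two exchanges bring [D2] innermost: first for [D1 f], then under the outer [D1]. *)
    assert (S1 : D2 (D1 (D1 f)) (X t) (Y t) = D1 (D1 (D2 f)) (X t) (Y t)).
    { rewrite (Cn_in_Schwarz D 0 (D1 f)); auto using Cn_in_D1.
      apply (D1_ext_in D); assumption. }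
    assert (S2 : D2 (D1 (D2 f)) (X t) (Y t) = D1 (D2 (D2 f)) (X t) (Y t)).
    { apply (Cn_in_Schwarz D 0 (D2 f)); auto using Cn_in_D2. }
    unfold along, cubic, a, b, c, d, e. rewrite S1, S2, (S0 _ _ Hxy). ring.
Qed.

(** * Divided differences *)

(** With [turn_v], the vector from the moving point to the fixed center [(x + u, y + v)] of the
    top-view circle. *)
Definition turn_u (u v t : R) : R := u * cos t - v * sin t.
Definition turn_v (u v t : R) : R := v * cos t + u * sin t.

Lemma is_derive_turn_u (u v t : R) : is_derive (turn_u u v) t (- turn_v u v t).
Proof. unfold turn_u, turn_v. auto_derive; [trivial|ring]. Qed.

Lemma is_derive_turn_v (u v t : R) : is_derive (turn_v u v) t (turn_u u v t).
Proof. unfold turn_u, turn_v. auto_derive; [trivial|ring]. Qed.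

Lemma is_derive_conic_x (x u v t : R) : is_derive (conic_x x u v) t (turn_v u v t).
Proof. unfold conic_x, turn_v. auto_derive; [trivial|ring]. Qed.

Lemma is_derive_conic_y (y u v t : R) : is_derive (conic_y y u v) t (- turn_u u v t).
Proof. unfold conic_y, turn_u. auto_derive; [trivial|ring]. Qed.

Lemma turn_u_0 (u v : R) : turn_u u v 0 = u.
Proof. unfold turn_u. rewrite sin_0, cos_0. ring. Qed.

Lemma turn_v_0 (u v : R) : turn_v u v 0 = v.
Proof. unfold turn_v. rewrite sin_0, cos_0. ring. Qed.

Lemma conic_x_0 (x u v : R) : conic_x x u v 0 = x.
Proof. unfold conic_x. rewrite sin_0, cos_0. ring. Qed.

Lemma conic_y_0 (y u v : R) : conic_y y u v 0 = y.
Proof. unfold conic_y. rewrite sin_0, cos_0. ring. Qed.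

Lemma is_derive_continuous (g : R -> R) (t l : R) : is_derive g t l -> continuous g t.
Proof. intros H. apply (ex_derive_continuous g). now exists l. Qed.

Lemma locally_along_conic (D : R -> R -> Prop) (x y u v : R) :
  open_2d D -> D x y -> locally 0 (fun t => D (conic_x x u v t) (conic_y y u v t)).
Proof.
  intros HD Hxy. destruct (HD x y Hxy) as [d Hd].
  pose proof (is_derive_continuous _ _ _ (is_derive_conic_x x u v 0)) as CX.
  pose proof (is_derive_continuous _ _ _ (is_derive_conic_y y u v 0)) as CY.
  assert (A : locally 0 (fun t => ball x d (conic_x x u v t))).
  { apply (CX (ball x d)). rewrite conic_x_0. apply locally_ball. }
  assert (B : locally 0 (fun t => ball y d (conic_y y u v t))).
  { apply (CY (ball y d)). rewrite conic_y_0. apply locally_ball. }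
  apply filter_imp with (2 := filter_and _ _ A B). intros t [At Bt]. now apply Hd.
Qed.

(** [F - G] has divided differences with respect to [(U1, V1)] and [(U2, V2)] that
    are continuous at 0; this is stable under ring operations. *)
Definition linked (U1 V1 U2 V2 F G : R -> R) : Prop :=
  continuous F 0 /\ continuous G 0 /\
  exists A B : R -> R, continuous A 0 /\ continuous B 0 /\
    forall t, F t - G t = A t * (U1 t - U2 t) + B t * (V1 t - V2 t).

Lemma continuous_Rplus (F G : R -> R) (t : R) :
  continuous F t -> continuous G t -> continuous (fun s => F s + G s) t.
Proof. apply (continuous_plus F G). Qed.

Lemma continuous_Rminus (F G : R -> R) (t : R) :
  continuous F t -> continuous G t -> continuous (fun s => F s - G s) t.
Proof. apply (continuous_minus F G). Qed.

Lemma continuous_Rmult (F G : R -> R) (t : R) :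
  continuous F t -> continuous G t -> continuous (fun s => F s * G s) t.
Proof. apply (continuous_mult F G). Qed.

Lemma continuous_pow (F : R -> R) (n : nat) (t : R) :
  continuous F t -> continuous (fun s => F s ^ n) t.
Proof.
  intros H. induction n as [|n IH]; simpl; [apply continuous_const|].
  now apply continuous_Rmult.
Qed.

Ltac continuity_R :=
  repeat match goal with
  | |- continuous (fun _ => _ + _) _ => apply continuous_Rplus
  | |- continuous (fun _ => _ - _) _ => apply continuous_Rminus
  | |- continuous (fun _ => _ * _) _ => apply continuous_Rmult
  | |- continuous (fun _ => _ ^ _) _ => apply continuous_pow
  | |- continuous _ _ => first [assumption | apply continuous_const]
  end.

Lemma linked_common (U1 V1 U2 V2 F : R -> R) : continuous F 0 -> linked U1 V1 U2 V2 F F.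
Proof.
  intros H. split; [exact H|split; [exact H|]]. exists (fun _ => 0), (fun _ => 0).
  repeat split; try apply continuous_const. intros. ring.
Qed.

Lemma linked_U (U1 V1 U2 V2 : R -> R) :
  continuous U1 0 -> continuous U2 0 -> linked U1 V1 U2 V2 U1 U2.
Proof.
  intros H1 H2. split; [exact H1|split; [exact H2|]]. exists (fun _ => 1), (fun _ => 0).
  repeat split; try apply continuous_const. intros. ring.
Qed.

Lemma linked_V (U1 V1 U2 V2 : R -> R) :
  continuous V1 0 -> continuous V2 0 -> linked U1 V1 U2 V2 V1 V2.
Proof.
  intros H1 H2. split; [exact H1|split; [exact H2|]]. exists (fun _ => 0), (fun _ => 1).
  repeat split; try apply continuous_const. intros. ring.
Qed.

Lemma linked_plus (U1 V1 U2 V2 F G F' G' : R -> R) :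
  linked U1 V1 U2 V2 F G -> linked U1 V1 U2 V2 F' G' -> linked U1 V1 U2 V2 (fun t => F t + F' t) (fun t => G t + G' t).
Proof.
  intros (HF & HG & A & B & HA & HB & E) (HF' & HG' & A' & B' & HA' & HB' & E').
  split; [continuity_R|split; [continuity_R|]].
  exists (fun t => A t + A' t), (fun t => B t + B' t).
  split; [continuity_R|split; [continuity_R|]]. intros t.
  transitivity ((F t - G t) + (F' t - G' t)); [ring|]. rewrite E, E'. ring.
Qed.

Lemma linked_mult (U1 V1 U2 V2 F G F' G' : R -> R) :
  linked U1 V1 U2 V2 F G -> linked U1 V1 U2 V2 F' G' -> linked U1 V1 U2 V2 (fun t => F t * F' t) (fun t => G t * G' t).
Proof.
  intros (HF & HG & A & B & HA & HB & E) (HF' & HG' & A' & B' & HA' & HB' & E').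
  split; [continuity_R|split; [continuity_R|]].
  exists (fun t => A t * F' t + G t * A' t), (fun t => B t * F' t + G t * B' t).
  split; [continuity_R|split; [continuity_R|]]. intros t.
  transitivity ((F t - G t) * F' t + G t * (F' t - G' t)); [ring|]. rewrite E, E'. ring.
Qed.

Lemma linked_minus (U1 V1 U2 V2 F G F' G' : R -> R) :
  linked U1 V1 U2 V2 F G -> linked U1 V1 U2 V2 F' G' -> linked U1 V1 U2 V2 (fun t => F t - F' t) (fun t => G t - G' t).
Proof.
  intros (HF & HG & A & B & HA & HB & E) (HF' & HG' & A' & B' & HA' & HB' & E').
  split; [continuity_R|split; [continuity_R|]].
  exists (fun t => A t - A' t), (fun t => B t - B' t).
  split; [continuity_R|split; [continuity_R|]]. intros t.
  transitivity ((F t - G t) - (F' t - G' t)); [ring|]. rewrite E, E'. ring.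
Qed.

Lemma linked_pow (U1 V1 U2 V2 F G : R -> R) (n : nat) :
  linked U1 V1 U2 V2 F G -> linked U1 V1 U2 V2 (fun t => F t ^ n) (fun t => G t ^ n).
Proof.
  intros H. induction n as [|n IH]; simpl.
  - apply linked_common, continuous_const.
  - now apply linked_mult.
Qed.

Ltac link_R :=
  repeat match goal with
  | |- linked _ _ _ _ (fun _ => _ + _) _ => apply linked_plus
  | |- linked _ _ _ _ (fun _ => _ - _) _ => apply linked_minus
  | |- linked _ _ _ _ (fun _ => _ * _) _ => apply linked_mult
  | |- linked _ _ _ _ (fun _ => _ ^ _) _ => apply linked_pow
  | |- linked _ _ _ _ _ _ =>
      first [apply linked_U | apply linked_V | apply linked_common]
  end.

(** The expression is polynomial in [(u, v)], with coefficients built from derivatives of [f] at the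
    common point [(X t, Y t)]. These need only be continuous, as the fourth derivatives are. *)
Lemma linked_contact_poly' (D : R -> R -> Prop) (f : R -> R -> R)
    (X Y U1 V1 U2 V2 : R -> R) :
  continuous U1 0 -> continuous V1 0 -> continuous U2 0 -> continuous V2 0 ->
  Cn_in D 4 f -> D (X 0) (Y 0) -> continuous X 0 -> continuous Y 0 ->
  linked U1 V1 U2 V2 (fun t => contact_poly' f (X t) (Y t) (U1 t) (V1 t))
       (fun t => contact_poly' f (X t) (Y t) (U2 t) (V2 t)).
Proof.
  intros HU1 HV1 HU2 HV2 Hf H0 HX HY.
  unfold contact_poly', cubic, cubic_slope_u, cubic_slope_v, along.
  assert (C : forall n F, Cn_in D n F -> continuous (fun t => F (X t) (Y t)) 0).
  { intros n F HF. apply continuous_along; try assumption.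
    now apply (Cn_in_continuous D n F). }
  link_R; try assumption; try apply continuous_const.
  all: eapply C; repeat (apply Cn_in_D1 || apply Cn_in_D2); exact Hf.
Qed.

(** * Contact conditions *)

Lemma is_derive_conic_z (z a b t : R) :
  is_derive (conic_z z a b) t (a * cos t + b * sin t).
Proof. unfold conic_z. auto_derive; [trivial|ring]. Qed.

Definition on_conic (F : R -> R -> R -> R -> R) (x y u v t : R) : R :=
  F (conic_x x u v t) (conic_y y u v t) (turn_u u v t) (turn_v u v t).

Lemma on_conic_0 (F : R -> R -> R -> R -> R) (x y u v : R) :
  on_conic F x y u v 0 = F x y u v.
Proof. unfold on_conic. now rewrite conic_x_0, conic_y_0, turn_u_0, turn_v_0. Qed.

Lemma is_derive_on_conic (D : R -> R -> Prop) (f : R -> R -> R) (x y u v t : R) :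
  open_2d D -> Cn_in D 4 f -> D (conic_x x u v t) (conic_y y u v t) ->
  is_derive (on_conic (fun x y _ _ => f x y) x y u v) t (on_conic (along f) x y u v t) /\
  is_derive (on_conic (along f) x y u v) t (on_conic (second_along f) x y u v t) /\
  is_derive (on_conic (second_along f) x y u v) t
    (on_conic (contact_poly f) x y u v t - on_conic (along f) x y u v t) /\
  is_derive (on_conic (contact_poly f) x y u v) t (on_conic (contact_poly' f) x y u v t).
Proof.
  intros HD Hf Ht.
  pose proof (is_derive_conic_x x u v t) as DX.
  pose proof (is_derive_conic_y y u v t) as DY.
  pose proof (is_derive_turn_u u v t) as DU.
  pose proof (is_derive_turn_v u v t) as DV.
  split; [|split; [|split]].
  - now apply (is_derive_along D 3).
  - apply (is_derive_first_along D); try assumption. apply (Cn_in_le D 2 4); [lia|exact Hf].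
  - apply (is_derive_second_along D); try assumption. apply (Cn_in_le D 3 4); [lia|exact Hf].
  - now apply (is_derive_contact_poly D).
Qed.

(** The derivatives of [z - g] up to order 4 vanish at 0. Orders 1 and 2 determine [a] and [b];
    orders 3 and 4 read [-a = q - g'] and [-b = q' - g''], whence [q = q' = 0]. The initial velocity
    is [(v, -u)], so regularity makes the radius positive. *)
Lemma contact_order_4_conditions (D : R -> R -> Prop) (f : R -> R -> R) (x y a b u v : R) :
  open_2d D -> Cn_in D 4 f -> D x y ->
  contact_order 4 f (conic_x x u v) (conic_y y u v) (conic_z (f x y) a b) ->
  0 < u ^ 2 + v ^ 2 /\ a = along f x y u v /\ b = second_along f x y u v /\
  contact_poly f x y u v = 0 /\ contact_poly' f x y u v = 0.
Proof.
  intros HD Hf Hxy [Hn Hl]. split.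
  { rewrite (is_derive_unique _ _ _ (is_derive_conic_x x u v 0)),
      (is_derive_unique _ _ _ (is_derive_conic_y y u v 0)), turn_u_0, turn_v_0 in Hn.
    destruct (Req_dec u 0) as [->|Nu].
    - destruct (Req_dec v 0) as [->|Nv]; [exfalso; apply Hn; f_equal; ring|].
      pose proof (pow2_gt_0 v Nv). lra.
    - pose proof (pow2_gt_0 u Nu). pose proof (pow2_ge_0 v). lra. }
  set (G := fun F => on_conic F x y u v).
  set (H := fun i t => match i with
    | 0%nat => conic_z (f x y) a b t - G (fun x y _ _ => f x y) t
    | 1%nat => a * cos t + b * sin t - G (along f) t
    | 2%nat => - a * sin t + b * cos t - G (second_along f) t
    | 3%nat => - a * cos t - b * sin t - (G (contact_poly f) t - G (along f) t)
    | _ => a * sin t - b * cos t - (G (contact_poly' f) t - G (second_along f) t)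
    end).
  assert (Hd : locally 0 (fun t => forall i, (i < 4)%nat -> is_derive (H i) t (H (S i) t))).
  { apply filter_imp with (2 := locally_along_conic D x y u v HD Hxy). intros t Ht.
    destruct (is_derive_on_conic D f x y u v t HD Hf Ht) as (E0 & E1 & E2 & E3).
    intros [|[|[|[|i]]]] Hi; [| | | |lia]; unfold H.
    - apply (is_derive_minus (conic_z (f x y) a b)); [apply is_derive_conic_z|exact E0].
    - apply (is_derive_minus (fun t => a * cos t + b * sin t)); [|exact E1].
      auto_derive; [trivial|ring].
    - apply (is_derive_minus (fun t => - a * sin t + b * cos t)); [|exact E2].
      auto_derive; [trivial|ring].
    - apply (is_derive_minus (fun t => - a * cos t - b * sin t)).
      + auto_derive; [trivial|ring].
      + now apply (is_derive_minus (G (contact_poly f))). }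
  assert (Hc : forall k, (k <= 4)%nat -> continuous (H k) 0).
  { intros k Hk. destruct (Nat.eq_dec k 4) as [->|N].
    (* At order 4 no further derivative is available. Continuity of [contact_poly'] is read off from
       [linked], taken with the same pair on both sides. *)
    - unfold H. apply continuous_Rminus.
      { apply (ex_derive_continuous (fun t => a * sin t - b * cos t)). now auto_derive. }
      apply continuous_Rminus.
      + assert (CU := is_derive_continuous _ _ _ (is_derive_turn_u u v 0)).
        assert (CV := is_derive_continuous _ _ _ (is_derive_turn_v u v 0)).
        eapply (linked_contact_poly' D f _ _ _ _ _ _ CU CV CU CV Hf).
        * now rewrite conic_x_0, conic_y_0.
        * eapply is_derive_continuous, is_derive_conic_x.
        * eapply is_derive_continuous, is_derive_conic_y.
      + eapply is_derive_continuous. apply (is_derive_on_conic D f x y u v 0 HD Hf).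
        now rewrite conic_x_0, conic_y_0.
    - eapply is_derive_continuous. apply (locally_singleton _ _ Hd). lia. }
  pose proof (little_o_derivatives_zero 4 H Hd Hc Hl) as Z.
  pose proof (Z 1%nat ltac:(lia)) as Z1. pose proof (Z 2%nat ltac:(lia)) as Z2.
  pose proof (Z 3%nat ltac:(lia)) as Z3. pose proof (Z 4%nat ltac:(lia)) as Z4.
  unfold H, G in Z1, Z2, Z3, Z4.
  rewrite !on_conic_0, sin_0, cos_0 in *. lra.
Qed.

(** * Slopes of the two defining polynomials and their determinant *)

Definition top_view_slope_u (theta x y u1 v1 u2 v2 : R) : R :=
  2 * x * ((x ^ 2 + y ^ 2 + 1 + 2 * x * u1 + 2 * y * v1)
           + (x ^ 2 + y ^ 2 + 1 + 2 * x * u2 + 2 * y * v2))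
  - 4 * tan theta ^ 2 * (u1 + u2).
Definition top_view_slope_v (theta x y u1 v1 u2 v2 : R) : R :=
  2 * y * ((x ^ 2 + y ^ 2 + 1 + 2 * x * u1 + 2 * y * v1)
           + (x ^ 2 + y ^ 2 + 1 + 2 * x * u2 + 2 * y * v2))
  - 4 * tan theta ^ 2 * (v1 + v2).

Lemma top_view_poly_difference (theta x y u1 v1 u2 v2 : R) :
  top_view_poly theta x y u1 v1 - top_view_poly theta x y u2 v2 =
  top_view_slope_u theta x y u1 v1 u2 v2 * (u1 - u2)
  + top_view_slope_v theta x y u1 v1 u2 v2 * (v1 - v2).
Proof. unfold top_view_poly, top_view_slope_u, top_view_slope_v. ring. Qed.

Definition contact_slope_u (f : R -> R -> R) (x y u1 v1 u2 v2 : R) : R :=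
  cubic_slope_u (D1 (D1 (D2 f)) x y) (D1 (D2 (D2 f)) x y) (D2 (D2 (D2 f)) x y)
    (D1 (D1 f) x y - D2 (D2 f) x y) (D1 (D2 f) x y) u1 v1 u2 v2.
Definition contact_slope_v (f : R -> R -> R) (x y u1 v1 u2 v2 : R) : R :=
  cubic_slope_v (D1 (D1 (D1 f)) x y) (D1 (D1 (D2 f)) x y) (D1 (D2 (D2 f)) x y)
    (D1 (D1 f) x y - D2 (D2 f) x y) (D1 (D2 f) x y) u1 v1 u2 v2.

Lemma contact_poly_difference (f : R -> R -> R) (x y u1 v1 u2 v2 : R) :
  contact_poly f x y u1 v1 - contact_poly f x y u2 v2 =
  contact_slope_u f x y u1 v1 u2 v2 * (u1 - u2)
  + contact_slope_v f x y u1 v1 u2 v2 * (v1 - v2).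
Proof. rewrite !contact_poly_cubic. apply cubic_difference. Qed.

(** Determinant of the linear system that the two difference identities impose on
    [(u1 - u2, v1 - v2)]; on the diagonal it is the Jacobian. *)
Definition slope_det (theta : R) (f : R -> R -> R) (x y u1 v1 u2 v2 : R) : R :=
  top_view_slope_u theta x y u1 v1 u2 v2 * contact_slope_v f x y u1 v1 u2 v2
  - top_view_slope_v theta x y u1 v1 u2 v2 * contact_slope_u f x y u1 v1 u2 v2.

Lemma jacobian2_slope_det (theta : R) (f : R -> R -> R) (x y u v : R) :
  jacobian2 (top_view_poly theta x y) (contact_poly f x y) u v =
  slope_det theta f x y u v u v.
Proof.
  unfold jacobian2, slope_det. f_equal; f_equal.
  - apply is_derive_unique. unfold top_view_poly, top_view_slope_u.
    auto_derive; [trivial|ring].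
  - apply is_derive_unique. unfold contact_slope_v, cubic_slope_v.
    apply (is_derive_ext _ _ _ _ (fun s => eq_sym (contact_poly_cubic f x y u s))).
    unfold cubic. auto_derive; [trivial|ring].
  - apply is_derive_unique. unfold top_view_poly, top_view_slope_v.
    auto_derive; [trivial|ring].
  - apply is_derive_unique. unfold contact_slope_u, cubic_slope_u.
    apply (is_derive_ext _ _ _ _ (fun s => eq_sym (contact_poly_cubic f x y s v))).
    unfold cubic. auto_derive; [trivial|ring].
Qed.

(** The polynomial depends only on the power of the origin with respect to the circle and on the
    squared radius [u^2 + v^2], both independent of the point chosen on the circle. *)
Lemma top_view_poly_on_conic (theta x y u v t : R) :
  on_conic (top_view_poly theta) x y u v t = top_view_poly theta x y u v.
Proof.
  unfold on_conic, top_view_poly, conic_x, conic_y, turn_u, turn_v.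
  pose proof (sin2_cos2 t) as T. unfold Rsqr in T.
  assert (K : sin t ^ 2 = 1 - cos t ^ 2) by (simpl; lra).
  f_equal; [f_equal|f_equal]; ring_simplify; rewrite K; ring.
Qed.

Theorem theorem13 :
  forall (theta : R) (x0 y0 r : R) (f : R -> R -> R) (a b u v : R -> R -> R),
    0 < theta < PI / 2 ->
    0 < r ->
    Cn_in (in_disk x0 y0 r) 4 f ->
    continuous_in (in_disk x0 y0 r) a ->
    continuous_in (in_disk x0 y0 r) b ->
    continuous_in (in_disk x0 y0 r) u ->
    continuous_in (in_disk x0 y0 r) v ->
    (forall x y, in_disk x0 y0 r x y ->
       ~ multiple_conic theta f x y (u x y) (v x y)) ->
    (forall x y, in_disk x0 y0 r x y ->
       contact_order 4 f
         (conic_x x (u x y) (v x y))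
         (conic_y y (u x y) (v x y))
         (conic_z (f x y) (a x y) (b x y))) ->
    (forall x y, in_disk x0 y0 r x y ->
       top_view_is_projected_arc (PI / 2 - theta) x y (u x y) (v x y)) ->
    forall x y, in_disk x0 y0 r x y ->
      exists eps : R, 0 < eps /\
        forall t, Rabs t < eps ->
          in_disk x0 y0 r
            (conic_x x (u x y) (v x y) t) (conic_y y (u x y) (v x y) t) /\
          conic_z (f x y) (a x y) (b x y) t =
            f (conic_x x (u x y) (v x y) t) (conic_y y (u x y) (v x y) t).
Proof.
  intros theta x0 y0 r f a b u v Hth _ Hf _ _ Hu Hv Hmult Hcontact Hview x y Hxy.
  set (D := in_disk x0 y0 r) in *.
  assert (HD : open_2d D) by apply in_disk_open.
  assert (Hroots : forall x y, D x y -> top_view_poly theta x y (u x y) (v x y) = 0 /\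
    contact_poly f x y (u x y) (v x y) = 0 /\ contact_poly' f x y (u x y) (v x y) = 0).
  { intros s t Hst.
    destruct (contact_order_4_conditions D f s t _ _ _ _ HD Hf Hst (Hcontact s t Hst))
      as (P & _ & _ & Q & Q').
    split; [|now split]. now apply top_view_poly_of_projected_arc; [| |apply Hview]. }
  destruct (contact_order_4_conditions D f x y _ _ _ _ HD Hf Hxy (Hcontact x y Hxy))
    as (_ & Ha & Hb & _ & _).
  assert (Hdet0 : slope_det theta f x y (u x y) (v x y) (u x y) (v x y) <> 0).
  { intros E. apply (Hmult x y Hxy). destruct (Hroots x y Hxy) as (P & Q & _).
    repeat split; [exact P|exact Q|]. now rewrite jacobian2_slope_det. }
  pose proof (locally_along_conic D x y (u x y) (v x y) HD Hxy) as Hloc.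
  set (u0 := u x y) in *. set (v0 := v x y) in *.
  set (X := conic_x x u0 v0) in *. set (Y := conic_y y u0 v0) in *.
  set (U1 := turn_u u0 v0). set (V1 := turn_v u0 v0).
  set (U2 := fun t => u (X t) (Y t)). set (V2 := fun t => v (X t) (Y t)).
  assert (X0 : X 0 = x) by apply conic_x_0. assert (Y0 : Y 0 = y) by apply conic_y_0.
  assert (CX : continuous X 0) by (eapply is_derive_continuous, is_derive_conic_x).
  assert (CY : continuous Y 0) by (eapply is_derive_continuous, is_derive_conic_y).
  assert (CU1 : continuous U1 0) by (eapply is_derive_continuous, is_derive_turn_u).
  assert (CV1 : continuous V1 0) by (eapply is_derive_continuous, is_derive_turn_v).
  assert (C : forall F, continuous_in D F -> continuous (fun t => F (X t) (Y t)) 0).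
  { intros F HF. apply continuous_along; try assumption. rewrite X0, Y0. now apply HF. }
  assert (CU2 : continuous U2 0) by now apply C.
  assert (CV2 : continuous V2 0) by now apply C.
  destruct (linked_contact_poly' D f X Y U1 V1 U2 V2) as (_ & _ & S1 & S2 & CS1 & CS2 & ES);
    try assumption.
  { now rewrite X0, Y0. }
  assert (CD : forall n F, Cn_in D n F -> continuous (fun t => F (X t) (Y t)) 0).
  { intros n F HF. now apply C, (Cn_in_continuous D n). }
  set (A1 := fun t => top_view_slope_u theta (X t) (Y t) (U1 t) (V1 t) (U2 t) (V2 t)).
  set (A2 := fun t => top_view_slope_v theta (X t) (Y t) (U1 t) (V1 t) (U2 t) (V2 t)).
  set (B1 := fun t => contact_slope_u f (X t) (Y t) (U1 t) (V1 t) (U2 t) (V2 t)).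
  set (B2 := fun t => contact_slope_v f (X t) (Y t) (U1 t) (V1 t) (U2 t) (V2 t)).
  assert (CA1 : continuous A1 0) by (unfold A1, top_view_slope_u; continuity_R).
  assert (CA2 : continuous A2 0) by (unfold A2, top_view_slope_v; continuity_R).
  assert (CB1 : continuous B1 0).
  { unfold B1, contact_slope_u, cubic_slope_u. continuity_R.
    all: eapply CD; repeat (apply Cn_in_D1 || apply Cn_in_D2); exact Hf. }
  assert (CB2 : continuous B2 0).
  { unfold B2, contact_slope_v, cubic_slope_v. continuity_R.
    all: eapply CD; repeat (apply Cn_in_D1 || apply Cn_in_D2); exact Hf. }
  assert (Hq : locally 0 (fun t => on_conic (contact_poly f) x y u0 v0 t = 0)).
  (* Cramer's rule: with [(du, dv)] the difference of the two pairs, [A1 du + A2 dv = 0] and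
     [B1 du + B2 dv = q]; substituting the solution into [q' = S1 du + S2 dv] gives this numerator
     and determinant. *)
  { apply (linear_ode_zero _ (on_conic (contact_poly' f) x y u0 v0)
      (fun t => S2 t * A1 t - S1 t * A2 t) (fun t => A1 t * B2 t - A2 t * B1 t)).
    - apply filter_imp with (2 := Hloc). intros t Ht.
      now apply (is_derive_on_conic D f x y u0 v0 t HD Hf).
    - apply filter_imp with (2 := Hloc). intros t Ht.
      destruct (Hroots _ _ Ht) as (P2 & Q2 & Q2').
      fold (U2 t) (V2 t) in P2, Q2, Q2'.
      pose proof (top_view_poly_on_conic theta x y u0 v0 t) as P1.
      destruct (Hroots x y Hxy) as (P0 & _ & _). fold u0 v0 in P0. rewrite P0 in P1.
      pose proof (top_view_poly_difference theta (X t) (Y t) (U1 t) (V1 t) (U2 t) (V2 t)) as EP.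
      pose proof (contact_poly_difference f (X t) (Y t) (U1 t) (V1 t) (U2 t) (V2 t)) as EQ.
      specialize (ES t). unfold on_conic in *. fold X Y U1 V1 in P1 |- *.
      fold (A1 t) (A2 t) in EP. fold (B1 t) (B2 t) in EQ.
      rewrite P1, P2, Rminus_0_r in EP. rewrite Q2, Rminus_0_r in EQ.
      rewrite Q2', Rminus_0_r in ES. fold (X t) (Y t) (U1 t) (V1 t).
      rewrite ES, EQ.
      (* The division-free form of the elimination: the second summand contains the factor
         [A1 du + A2 dv], which is 0 by [EP]. *)
      transitivity ((S2 t * A1 t - S1 t * A2 t)
          * (B1 t * (U1 t - U2 t) + B2 t * (V1 t - V2 t))
        + (S1 t * B2 t - S2 t * B1 t) * (A1 t * (U1 t - U2 t) + A2 t * (V1 t - V2 t)));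
        [ring|].
      rewrite <- EP. ring.
    - continuity_R.
    - continuity_R.
    (* At [t = 0] the two pairs coincide, so nonmultiplicity applies. *)
    - unfold A1, A2, B1, B2, U2, V2, U1, V1. rewrite X0, Y0, turn_u_0, turn_v_0.
      exact Hdet0.
    - rewrite on_conic_0. now apply Hroots. }
  assert (Hz : locally 0 (fun t =>
    conic_z (f x y) (a x y) (b x y) t - on_conic (fun x y _ _ => f x y) x y u0 v0 t = 0)).
  { apply (zero_of_third_order_ode _
      (fun t => a x y * cos t + b x y * sin t - on_conic (along f) x y u0 v0 t)
      (fun t => - a x y * sin t + b x y * cos t - on_conic (second_along f) x y u0 v0 t)).
    - apply filter_imp with (2 := Hloc). intros t Ht.
      apply (is_derive_minus (conic_z (f x y) (a x y) (b x y))); [apply is_derive_conic_z|].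
      now apply (is_derive_on_conic D f x y u0 v0 t HD Hf).
    - apply filter_imp with (2 := Hloc). intros t Ht.
      apply (is_derive_minus (fun t => a x y * cos t + b x y * sin t)).
      + auto_derive; [trivial|ring].
      + now apply (is_derive_on_conic D f x y u0 v0 t HD Hf).
    (* Here [q = 0] enters: it turns [g''' = q - g'] into the equation [z''' = -z'] satisfied by the
       conic. *)
    - apply filter_imp with (2 := filter_and _ _ Hloc Hq). intros t [Ht Et].
      replace (- (a x y * cos t + b x y * sin t - on_conic (along f) x y u0 v0 t))
        with ((- a x y * cos t - b x y * sin t)
          - (on_conic (contact_poly f) x y u0 v0 t - on_conic (along f) x y u0 v0 t))
        by (rewrite Et; ring).
      apply (is_derive_minus (fun t => - a x y * sin t + b x y * cos t)).
      + auto_derive; [trivial|ring].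
      + now apply (is_derive_on_conic D f x y u0 v0 t HD Hf).
    - rewrite on_conic_0. unfold conic_z. rewrite sin_0, cos_0. ring.
    - rewrite on_conic_0, sin_0, cos_0. lra.
    - rewrite on_conic_0, sin_0, cos_0. lra. }
  destruct (proj1 (locally_0_iff _) (filter_and _ _ Hloc Hz)) as (eps & Peps & Heps).
  exists eps. split; [exact Peps|]. intros t Ht. destruct (Heps t Ht) as [Dt Zt].
  split; [exact Dt|]. apply Rminus_diag_uniq. exact Zt.
Qed.
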